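(* Let $(a_{k})_{k\ge 0}$ be the sequence defined by $a_{0}=1$, $a_{1}=5$ and $a_{k+1}=6a_{k}-a_{k-1}$ for all integers $k\ge 1$. For integers $k\ge 0$ put $$m_{k}=\frac{1}{4}\left[\left(\sqrt{2}+1\right)\left(3+2\sqrt{2}\right)^{k}-\left(\sqrt{2}-1\right)\left(3-2\sqrt{2}\right)^{k}-2\right].$$ Then every $m_{k}$ is a nonnegative integer, $m_{k}=6m_{k-1}-m_{k-2}+2$ for all $k\ge 2$, and the triples $(m_{k},m_{k}+1,a_{k})$, $k\ge 0$, are exactly all the Pythagorean triples whose second component exceeds the first by one; that is, for nonnegative integers $x, z$ one has $x^{2}+(x+1)^{2}=z^{2}$ if and only if there is an integer $k\ge 0$ with $x=m_{k}$ and $z=a_{k}$.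
   Context: Here a Pythagorean triple is a triple $(x,y,z)$ of nonnegative integers with $x^{2}+y^{2}=z^{2}$; the degenerate triple $(0,1,1)$ is counted and corresponds to $k=0$. *)

(* Defs.v *)
From mathcomp Require Import all_boot all_order all_algebra.
From mathcomp Require Import reals.

Set Implicit Arguments.
Unset Strict Implicit.
Unset Printing Implicit Defensive.

Import Order.TTheory GRing.Theory Num.Theory.

Local Open Scope ring_scope.

(* Degenerate triples such as (0, 1, 1) are included. *)
Definition pythagorean_triple (x y z : nat) : Prop :=
  (x ^ 2 + y ^ 2 = z ^ 2)%N.

Fixpoint a (k : nat) : int :=
  match k with
  | 0 => 1
  | 1 => 5
  | (k''.+1 as k').+1 => 6 * a k' - a k''
  end.

Definition m (R : realType) (k : nat) : R :=
  1 / 4 * ((Num.sqrt 2 + 1) * (3 + 2 * Num.sqrt 2) ^+ k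
           - (Num.sqrt 2 - 1) * (3 - 2 * Num.sqrt 2) ^+ k - 2).

(* Main.v *)
(** The solutions of x^2 + (x+1)^2 = z^2 form a single orbit: the map
    (x, z) |-> (3x + 2z + 1, 4x + 3z + 2) sends solutions to solutions, and its
    inverse strictly decreases x on every solution with x >= 3; the only
    solution with x < 3 is (0, 1).  In terms of the unit 3 + 2 sqrt 2, the map
    multiplies (2x + 1) + z sqrt 2 by 3 + 2 sqrt 2 (and the conjugate by
    3 - 2 sqrt 2), which gives the closed form of x. *)
Require Import Defs.
From mathcomp Require Import all_boot all_order all_algebra.
From mathcomp Require Import reals.
From mathcomp Require Import zify ring.

Import Order.TTheory GRing.Theory Num.Theory.

Local Open Scope ring_scope.

Definition twin_step (p : nat * nat) : nat * nat :=
  (3 * p.1 + 2 * p.2 + 1, 4 * p.1 + 3 * p.2 + 2)%N.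

Definition twin_sol (k : nat) : nat * nat := iter k twin_step (0, 1)%N.

Lemma twin_solP k :
  ((twin_sol k).1 ^ 2 + ((twin_sol k).1 + 1) ^ 2 = (twin_sol k).2 ^ 2)%N.
Proof.
elim: k => [//|k]; rewrite /twin_sol iterS /twin_step /=.
by case: (iter _ _ _) => x z /=; nia.
Qed.

(** The inverse step is [(3x + 1 - 2z, 3z - (4x + 2))]: the first two bounds keep both truncated
    differences exact, and [x < z] makes the first one smaller than [x]. The first bound, squared,
    is [(x - 3)(x + 1) >= 0]. *)
Lemma twin_descent x z :
  (3 <= x)%N -> (x ^ 2 + (x + 1) ^ 2 = z ^ 2)%N ->
  [/\ (2 * z <= 3 * x + 1)%N, (4 * x + 2 <= 3 * z)%N & (x < z)%N].
Proof. by move=> x3 e; split; nia. Qed.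

Lemma twin_sol_complete x z :
  (x ^ 2 + (x + 1) ^ 2 = z ^ 2)%N -> exists k, twin_sol k = (x, z).
Proof.
elim/ltn_ind: x z => x IH z e.
have [x3|x3] := leqP 3 x; last first.
  have z4 : (z < 4)%N by nia.
  exists 0%N; rewrite /twin_sol /=.
  by case: x {IH} x3 e => [|[|[|//]]] _; case: z z4 => [|[|[|[|//]]]].
have [h1 h2 h3] := twin_descent x z x3 e.
have [||k ek] := IH (3 * x + 1 - 2 * z)%N _ (3 * z - (4 * x + 2))%N.
- by lia.
- have [x' ex] : exists x', (3 * x + 1 = 2 * z + x')%N
    by exists (3 * x + 1 - 2 * z)%N; lia.
  have [z' ez] : exists z', (3 * z = 4 * x + 2 + z')%N
    by exists (3 * z - (4 * x + 2))%N; lia.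
  rewrite ex ez !addKn.
  have xE : x = (3 * x' + 2 * z' + 1)%N by lia.
  have zE : z = (4 * x' + 3 * z' + 2)%N by lia.
  (* The step preserves [(2x + 1)^2 - 2z^2], so the equation passes to [x'], [z']. *)
  by move: e; rewrite xE zE; nia.
exists k.+1; rewrite /twin_sol iterS -/(twin_sol k) ek /twin_step /=.
by congr pair; lia.
Qed.

(** The linear part of the step has characteristic polynomial [t^2 - 6t + 1]; the recurrence has
    order two, hence the induction on two consecutive terms. *)
Lemma a_twin_sol k : a k = (twin_sol k).2.
Proof.
suff [] : a k = (twin_sol k).2 /\ a k.+1 = (twin_sol k.+1).2 by [].
elim: k => [//|k [e0 e1]]; split=> //.
have -> : a k.+2 = 6 * a k.+1 - a k by [].
rewrite e0 e1 /twin_sol !iterS /twin_step /=.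
by case: (iter _ _ _) => x z /=; lia.
Qed.

Section ClosedForm.
Variable R : realType.

Lemma sqr_sqrt2 : Num.sqrt 2 ^+ 2 = 2 :> R.
Proof. by rewrite sqr_sqrtr. Qed.

(** The second identity is the conjugate of the first, negated. Their difference is [2(2x + 1)],
    which isolates [x]. *)
Lemma twin_sol_unit k (x := (twin_sol k).1%:R : R) (z := (twin_sol k).2%:R : R) :
  (Num.sqrt 2 + 1) * (3 + 2 * Num.sqrt 2) ^+ k = 2 * x + 1 + z * Num.sqrt 2 /\
  (Num.sqrt 2 - 1) * (3 - 2 * Num.sqrt 2) ^+ k = z * Num.sqrt 2 - (2 * x + 1).
Proof.
rewrite {}/x {}/z; elim: k => [|k [e1 e2]].
  by rewrite /twin_sol /= !expr0; split; ring.
rewrite !exprSr !mulrA e1 e2 /twin_sol iterS -/(twin_sol k) /twin_step /=.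
case: (twin_sol k) => x z /=.
by split; ring: sqr_sqrt2.
Qed.

Lemma m_twin_sol k : m R k = (twin_sol k).1%:R.
Proof. by rewrite /m; have [-> ->] := twin_sol_unit k; field. Qed.

End ClosedForm.

Theorem mainTheorem4 (R : realType) :
  [/\ forall k : nat, m R k \is a Num.nat,
      forall k : nat, (2 <= k)%N ->
        m R k = 6 * m R (k - 1)%N - m R (k - 2)%N + 2,
      forall x y z : nat,
        (pythagorean_triple x y z /\ y = (x + 1)%N) <->
        (exists k : nat,
          [/\ x%:R = m R k, y%:R = m R k + 1 & z%:R = (a k)%:~R :> R])
    & forall x z : nat,
        (x ^ 2 + (x + 1) ^ 2 = z ^ 2)%N <->
        (exists k : nat, x%:R = m R k /\ z%:Z = a k)].
Proof.
have solE (x z : nat) : (x ^ 2 + (x + 1) ^ 2 = z ^ 2)%N <->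
    exists k, twin_sol k = (x, z).
  split=> [|[k e]]; first exact: twin_sol_complete.
  by have := twin_solP k; rewrite e.
split.
- by move=> k; rewrite m_twin_sol natr_nat.
(* The sequence [2x + 1] satisfies the homogeneous recurrence; passing to [x] produces the constant
   2. *)
- case=> [|[|k]] // _; rewrite subSS subn0 !subSS subn0 !m_twin_sol.
  rewrite /twin_sol !iterS /twin_step /=.
  by case: (iter _ _ _) => x z /=; ring.
- move=> x y z; rewrite /pythagorean_triple; split.
    move=> [e ey]; move: e; rewrite ey => /solE[k e]; exists k.
    by rewrite m_twin_sol a_twin_sol e natrD.
  (* Casts from [nat] to [R] are injective, so the real equalities descend to naturals. *)
  case=> k; rewrite m_twin_sol a_twin_sol => -[ex ey ez].
  move/eqP: ex; rewrite eqr_nat => /eqP ->.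
  move/eqP: ey; rewrite natr1 eqr_nat -addn1 => /eqP ->.
  move/eqP: ez; rewrite -pmulrn eqr_nat => /eqP ->.
  by rewrite twin_solP.
- move=> x z; rewrite solE; split=> -[k].
    by move=> e; exists k; rewrite m_twin_sol a_twin_sol e.
  rewrite m_twin_sol a_twin_sol => -[/eqP]; rewrite eqr_nat => /eqP -> [->].
  by exists k; case: (twin_sol k).
Qed.
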